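(* Let $k$ be an algebraically closed field of characteristic $0$ and $R=k\langle x,y\rangle/(xy-yx-y^2)$. Let $\rho_n:R\to M_n(k)$ be an arbitrary $n$-dimensional representation of $R$ and $A_n=\rho_n(R)$ its image algebra. Then $\dim_k A_n\le \frac{n(n+2)}{4}$ if $n$ is even, and $\dim_k A_n\le\frac{(n+1)^2}{4}$ if $n$ is odd. This estimate is optimal: it is attained for the image algebra of any representation for which the Jordan normal form of $Y=\rho_n(y)$ is one full block of size $n$. *)

(* Defs.v *)
From HB Require Import structures.
From mathcomp Require Import all_boot all_order all_algebra.
From mathcomp Require Import boolp.
From mathcomp Require Import monalg.

Set Implicit Arguments.
Unset Strict Implicit.
Unset Printing Implicit Defensive.

Import GRing.Theory.

Local Open Scope ring_scope.
Local Open Scope quotient_scope.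

Section Ideal2.
Variables (A : nzRingType) (g : A).

(* The two-sided ideal of A generated by g. *)
Definition ideal2 : {pred A} :=
  fun z => `[< exists s : seq (A * A), z = \sum_(p <- s) p.1 * g * p.2 >].

Lemma ideal2P z :
  reflect (exists s : seq (A * A), z = \sum_(p <- s) p.1 * g * p.2)
          (z \in ideal2).
Proof. exact: asboolP. Qed.

Lemma ideal2_gen : g \in ideal2.
Proof. by apply/ideal2P; exists [:: (1, 1)]; rewrite big_seq1 mul1r mulr1. Qed.

Lemma ideal2_zmod_closed : zmod_closed ideal2.
Proof.
split=> [|u v /ideal2P[s ->] /ideal2P[t ->]]; apply/ideal2P.
  by exists [::]; rewrite big_nil.
exists (s ++ [seq (- p.1, p.2) | p <- t]).
rewrite big_cat big_map -sumrN; congr (_ + _); apply: eq_bigr => p _ /=.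
by rewrite !mulNr.
Qed.

HB.instance Definition _ := GRing.isZmodClosed.Build A ideal2 ideal2_zmod_closed.

Lemma ideal2Ml a u : u \in ideal2 -> a * u \in ideal2.
Proof.
move=> /ideal2P[s ->]; apply/ideal2P; exists [seq (a * p.1, p.2) | p <- s].
by rewrite big_map mulr_sumr; apply: eq_bigr => p _; rewrite /= !mulrA.
Qed.

Lemma ideal2Mr a u : u \in ideal2 -> u * a \in ideal2.
Proof.
move=> /ideal2P[s ->]; apply/ideal2P; exists [seq (p.1, p.2 * a) | p <- s].
by rewrite big_map mulr_suml; apply: eq_bigr => p _; rewrite /= !mulrA.
Qed.

Lemma ideal2_mul_congr u u' v v' :
  u - u' \in ideal2 -> v - v' \in ideal2 -> u * v - u' * v' \in ideal2.
Proof.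
move=> Iu Iv; have -> : u * v - u' * v' = (u - u') * v + u' * (v - v').
  by rewrite mulrBl mulrBr addrA subrK.
by apply: rpredD; [apply: ideal2Mr | apply: ideal2Ml].
Qed.

End Ideal2.

Lemma rmorph_jordan_rel (A B : nzRingType) (f : {rmorphism A -> B}) (x y : A) :
  f (x * y - y * x - y ^+ 2) = f x * f y - f y * f x - f y ^+ 2.
Proof. by rewrite !rmorphB rmorphXn !rmorphM. Qed.

Section JordanPlane.
Variable k : fieldType.

(* k<x, y>: monoid algebra of the free monoid on two letters, the letter     *)
(* false standing for x and true for y.                                      *)
Local Notation kxy := {malg k[{fmonom bool}]}.

Definition free_x : kxy := << fmu false >>.
Definition free_y : kxy := << fmu true >>.

Definition jordan_rel : kxy :=
  free_x * free_y - free_y * free_x - free_y ^+ 2.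

Local Notation I := (ideal2 jordan_rel).

Lemma free_scalerAr (c : k) (u v : kxy) : c *: (u * v) = u * (c *: v).
Proof.
rewrite -[c *: v]mul_malgC -[LHS]mul_malgC [LHS]mulrA [RHS]mulrA.
apply: (congr1 (fun w : kxy => w * v)).
rewrite !malgM_def fgmulUg fgmulgU; apply: eq_bigr => m _.
by rewrite mulrC mul1m mulm1.
Qed.

Lemma ideal2Z (c : k) u : u \in I -> c *: u \in I.
Proof. by rewrite -mul_malgC; apply: ideal2Ml. Qed.

Lemma augmentation_ex :
  exists eps : {rmorphism kxy -> k}, eps free_x = 0 /\ eps free_y = 0.
Proof.
have fmuN1 b : (fmu b == mone :> {fmonom bool}) = false.
  by apply/negP=> /eqP; rewrite fmuE [mone]fmoneE.
exists (mcoeff (mone : {fmonom bool}) : {rmorphism kxy -> k}).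
by split; rewrite [LHS]mcoeffU fmuN1.
Qed.

Lemma one_notin_jordan : 1 \notin I.
Proof.
have [eps [eps_x eps_y]] := augmentation_ex.
have eps_rel : eps jordan_rel = 0.
  apply: etrans (rmorph_jordan_rel eps free_x free_y) _.
  by rewrite eps_x eps_y mul0r expr0n !subr0.
apply/negP => /ideal2P[s /(congr1 eps)]; rewrite rmorph1 rmorph_sum big1.
  by move/eqP; rewrite oner_eq0.
by move=> p _; rewrite 2!rmorphM eps_rel mulr0 mul0r.
Qed.

Definition jordan_plane := Quotient.quot I.

HB.instance Definition _ := GRing.Zmodule.on jordan_plane.
HB.instance Definition _ := EqQuotient.on jordan_plane.
HB.instance Definition _ :=
  @isZmodQuotient.Build kxy (Quotient.equiv I) 0 -%R +%R jordan_plane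
    (lock _) (@Quotient.pi_opp _ _) (@Quotient.pi_add _ _).

Local Notation JP := jordan_plane.

Definition jp_one : JP := lift_cst JP 1.
Definition jp_mul := lift_op2 JP *%R.
Definition jp_scale (c : k) := lift_op1 JP ( *:%R c).

Lemma jp_eqP (u v : kxy) : reflect (\pi_JP u = \pi_JP v) (u - v \in I).
Proof. by rewrite Quotient.idealrBE; apply: eqP. Qed.

Lemma repr_jp (u : kxy) : repr (\pi_JP u) - u \in I.
Proof. by apply/jp_eqP; rewrite reprK. Qed.

Lemma pi_jp_mul : {morph \pi_JP : u v / u * v >-> jp_mul u v}.
Proof.
move=> u v; unlock jp_mul; apply/esym/jp_eqP.
exact: ideal2_mul_congr (repr_jp u) (repr_jp v).
Qed.

Lemma pi_jp_scale c : {morph \pi_JP : u / c *: u >-> jp_scale c u}.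
Proof.
by move=> u; unlock jp_scale; apply/esym/jp_eqP; rewrite -scalerBr ideal2Z ?repr_jp.
Qed.

Lemma pi_jp_one : \pi_JP 1 = jp_one. Proof. by unlock jp_one. Qed.

Lemma pi_jp_add : {morph \pi_JP : u v / u + v}.
Proof. exact: Quotient.pi_add. Qed.

Lemma pi_jp0 : \pi_JP 0 = 0.
Proof. exact: raddf0. Qed.

Lemma pi_jpB : {morph \pi_JP : u v / u - v}.
Proof. exact: raddfB. Qed.

Lemma jp_mulA : associative jp_mul.
Proof.
by move=> u v w; rewrite -[u]reprK -[v]reprK -[w]reprK -!pi_jp_mul mulrA.
Qed.

Lemma jp_mul1 : left_id jp_one jp_mul.
Proof. by move=> u; rewrite -[u]reprK -pi_jp_one -pi_jp_mul mul1r. Qed.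

Lemma jp_mulr1 : right_id jp_one jp_mul.
Proof. by move=> u; rewrite -[u]reprK -pi_jp_one -pi_jp_mul mulr1. Qed.

Lemma jp_mulDl : left_distributive jp_mul +%R.
Proof.
move=> u v w; rewrite -[u]reprK -[v]reprK -[w]reprK.
by rewrite -pi_jp_add -!pi_jp_mul -pi_jp_add mulrDl.
Qed.

Lemma jp_mulDr : right_distributive jp_mul +%R.
Proof.
move=> u v w; rewrite -[u]reprK -[v]reprK -[w]reprK.
by rewrite -pi_jp_add -!pi_jp_mul -pi_jp_add mulrDr.
Qed.

Lemma jp_one_neq0 : jp_one != 0.
Proof.
apply/eqP; rewrite -pi_jp_one -pi_jp0 => /jp_eqP.
by rewrite subr0 (negPf one_notin_jordan).
Qed.

HB.instance Definition _ := GRing.Zmodule_isNzRing.Build jordan_plane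
  jp_mulA jp_mul1 jp_mulr1 jp_mulDl jp_mulDr jp_one_neq0.

Lemma jp_scaleA a b u : jp_scale a (jp_scale b u) = jp_scale (a * b) u.
Proof. by rewrite -[u]reprK -!pi_jp_scale scalerA. Qed.

Lemma jp_scale1 : left_id 1 jp_scale.
Proof. by move=> u; rewrite -[u]reprK -pi_jp_scale scale1r. Qed.

Lemma jp_scaleDr : right_distributive jp_scale +%R.
Proof.
move=> a u v; rewrite -[u]reprK -[v]reprK.
by rewrite -pi_jp_add -!pi_jp_scale -pi_jp_add scalerDr.
Qed.

Lemma jp_scaleDl u : {morph jp_scale^~ u : a b / a + b}.
Proof.
by move=> a b; rewrite -[u]reprK -!pi_jp_scale -pi_jp_add scalerDl.
Qed.

HB.instance Definition _ := GRing.Zmodule_isLmodule.Build k jordan_plane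
  jp_scaleA jp_scale1 jp_scaleDr jp_scaleDl.

Lemma jp_scaleAl (a : k) (u v : JP) : a *: (u * v) = a *: u * v.
Proof.
rewrite -[u]reprK -[v]reprK.
by rewrite -[LHS]/(jp_scale a (jp_mul _ _)) -[RHS]/(jp_mul (jp_scale a _) _)
  -!(pi_jp_mul, pi_jp_scale) scalerAl.
Qed.

HB.instance Definition _ := GRing.Lmodule_isLalgebra.Build k jordan_plane
  jp_scaleAl.

Lemma jp_scaleAr (a : k) (u v : JP) : a *: (u * v) = u * (a *: v).
Proof.
rewrite -[u]reprK -[v]reprK.
by rewrite -[LHS]/(jp_scale a (jp_mul _ _)) -[RHS]/(jp_mul _ (jp_scale a _))
  -!(pi_jp_mul, pi_jp_scale) free_scalerAr.
Qed.

HB.instance Definition _ := GRing.Lalgebra_isAlgebra.Build k jordan_plane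
  jp_scaleAr.

Definition jp_x : jordan_plane := \pi free_x.
Definition jp_y : jordan_plane := \pi free_y.

Lemma pi_jpM (u v : kxy) : \pi_JP (u * v) = \pi_JP u * \pi_JP v.
Proof. exact: pi_jp_mul. Qed.

Lemma jp_relation : jp_x * jp_y - jp_y * jp_x - jp_y ^+ 2 = 0.
Proof.
by rewrite expr2 -!pi_jpM -!pi_jpB -pi_jp0; apply/jp_eqP; rewrite subr0 ideal2_gen.
Qed.

End JordanPlane.

Section LinearRange.
Variables (k : fieldType) (U : lmodType k) (V : vectType k).
Variable f : {linear U -> V}.

Lemma linear_range_ex :
  exists W : {vspace V}, forall v, v \in W <-> exists u, f u = v.
Proof.
pose P d := `[< exists2 W : {vspace V}, \dim W = d
                & forall v, v \in W -> exists u, f u = v >].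
have exP : exists d, P d.
  exists 0%N; apply/asboolP; exists 0%VS; first exact: dimv0.
  by move=> v; rewrite memv0 => /eqP ->; exists 0; rewrite linear0.
have ubP d : P d -> (d <= \dim {:V})%N.
  by move=> /asboolP[W <- _]; rewrite dimvS ?subvf.
case: (ex_maxnP exP ubP) => d /asboolP[W dW fW] maxd.
exists W => v; split=> [/fW //|[u fuv]]; apply: contraT => vNW.
suff /maxd : P (\dim (W + <[v]>)%VS).
  rewrite -dW => le_dim; case/negP: vNW.
  have /eqP -> : W == (W + <[v]>)%VS by rewrite eqEdim addvSl.
  by rewrite (subvP (addvSr _ _)) ?memv_line.
apply/asboolP; exists (W + <[v]>)%VS => // w.
move=> /memv_addP[w1 /fW[u1 <-] [w2 /vlineP[c ->] ->]].
by exists (u1 + c *: u); rewrite linearD linearZ fuv.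
Qed.

(* The range of f; U need not be finite dimensional. *)
Definition linear_range : {vspace V} := sval (cid linear_range_ex).

Lemma mem_linear_range v : v \in linear_range <-> exists u, f u = v.
Proof. exact: (svalP (cid linear_range_ex)). Qed.

End LinearRange.

Definition jordan_block (k : fieldType) (n : nat) (lambda : k) : 'M[k]_n :=
  \matrix_(i, j) (lambda *+ (i == j) + (i.+1 == j :> nat)%:R).

(* The Jordan normal form of Y is a single block of size n. *)
Definition full_jordan_block (k : fieldType) (n : nat) (Y : 'M[k]_n) : Prop :=
  exists lambda : k, Y ~_{in unitmx} jordan_block n lambda.

(* Main.v *)
From HB Require Import structures.
Require Import Defs.
From mathcomp Require Import all_boot all_order all_algebra.
From mathcomp Require Import monalg.
From mathcomp Require Import zify.

Set Implicit Arguments.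
Unset Strict Implicit.
Unset Printing Implicit Defensive.

Import GRing.Theory.
Local Open Scope ring_scope.

(** Write X and Y for the images of the two generators, so that
    XY - YX = Y^2, let them act on the right on the row vectors M = k^n, and let
    A be the image algebra.  The relation gives X Y^e = Y^e (X + eY) and
    Y^e X = (X - eY) Y^e, so A is spanned by the monomials Y^e X^l and every
    M Y^e is a submodule of M.

    Y is nilpotent: where Y acts invertibly, multiplying the relation by Y^-1 on
    both sides gives Y^-1 X - X Y^-1 = 1, and taking traces shows that the
    dimension is 0 in k, hence 0 ([no_invertible_jordan_pair]).  Applied to
    M Y^e this shows that the ranks r_e of Y^e strictly decrease until they
    reach 0, whence r_e <= n - e ([rank_Ypow]).

    Upper bound.  The quotient of M Y^e by M Y^(e+2) is a module over the dual
    numbers k[Y]/(Y^2) with r_e - r_(e+1) generators, and X acts on it linearly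
    over that commutative ring because XY - YX = Y^2 acts there as 0.  By
    Cayley-Hamilton, a polynomial Q_e in X, monic of degree r_e - r_(e+1) and
    with coefficients in k[Y], sends M Y^e into M Y^(e+2) ([monicX_step]).
    The product Q_e Q_(e+2) Q_(e+4) ... is again monic and annihilates M Y^e;
    call J_e its degree.  Hence Y^e X^l with l >= J_e can be rewritten in
    terms of monomials of larger degree in Y or smaller degree in X
    ([monicX_spanning]), and dim A <= J_0 + J_1 + ....  This double sum of the
    differences r_(e+2i) - r_(e+2i+1) telescopes in e to r_0 + r_2 + r_4 + ...,
    which is at most n + (n-2) + (n-4) + ..., and the last sum equals
    (n+1)^2/4 rounded down, the common value of the two bounds in the theorem.

    Optimality.  When the Jordan form of Y is one full block, Y^(n-1) is
    nonzero.  The derivation T -> TY - YT kills Y and sends X to Y^2, so its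
    d-th power sends Y^i X^d to d! Y^(i+2d) and kills all lower powers of X.
    In characteristic 0 the monomials Y^i X^d with i + 2d < n are therefore
    linearly independent, and there are n + (n-2) + (n-4) + ... of them
    ([dim_ker_adY]).  The nilpotent block itself occurs, its partner X being
    a weighted shift ([jordan_block_partner]). *)

(** * Moving X past powers of Y *)

Section Relation.
Variables (A : pzRingType) (X Y : A).
Hypothesis rel : X * Y - Y * X = Y ^+ 2.

Lemma jordan_swap : X * Y = Y * (X + Y).
Proof. by rewrite mulrDr -expr2 -rel addrC subrK. Qed.

Lemma jordan_swapX e : X * Y ^+ e = Y ^+ e * (X + Y *+ e).
Proof.
elim: e => [|e IH]; first by rewrite !expr0 mulr0n addr0 mulr1 mul1r.
rewrite exprSr mulrA IH -!mulrA; congr (_ * _).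
rewrite mulrDl jordan_swap mulrnAl -mulrnAr -mulrDr -addrA.
by rewrite -mulrS.
Qed.

Lemma jordan_swapXr e : Y ^+ e * X = (X - Y *+ e) * Y ^+ e.
Proof.
rewrite mulrBl jordan_swapX mulrDr mulrnAr mulrnAl.
by rewrite -exprSr -exprS addrK.
Qed.

End Relation.

(** * Nilpotency of Y and the ranks of its powers *)

Section Ranks.
Variables (k : fieldType) (n : nat) (X Y : 'M[k]_n).
Hypothesis k_char0 : [pchar k] =i pred0.
Hypothesis rel : X * Y - Y * X = Y ^+ 2.

(** The trace of V^-1 U - U V^-1 = 1 is 0, so the size is 0 in k. *)
Lemma no_invertible_jordan_pair (r : nat) (U V : 'M[k]_r) :
  U *m V - V *m U = V *m V -> V \in unitmx -> r = 0%N.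
Proof.
move=> UV Vu.
have E : invmx V *m U - U *m invmx V = 1%:M.
  transitivity (invmx V *m (U *m V - V *m U) *m invmx V).
    rewrite mulmxBr mulmxBl !mulmxA mulVmx // mul1mx.
    by rewrite -(mulmxA (_ *m U)) mulmxV // mulmx1.
  by rewrite UV mulmxA mulVmx // mul1mx mulmxV.
move/(congr1 mxtrace): E; rewrite raddfB /= mxtrace_mulC subrr mxtrace1.
by move/esym/eqP; rewrite (pcharf0P k).1 // => /eqP.
Qed.

Lemma Ypow_stable e : (Y ^+ e *m X <= Y ^+ e)%MS.
Proof.
have -> : Y ^+ e *m X = (X - Y *+ e) *m Y ^+ e := jordan_swapXr rel e.
exact: submxMl.
Qed.

Lemma Ypow_sub e i : (e <= i)%N -> (Y ^+ i <= Y ^+ e)%MS.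
Proof.
by move=> le_ei; rewrite -(subnK le_ei) exprD submxMl.
Qed.

(** If the rank stalls, Y is invertible on the row space of Y^e, which X also
    preserves; in a basis B of that space the two actions form an invertible
    pair as excluded above. *)
Lemma rank_Ypow_eq e : \rank (Y ^+ e.+1) = \rank (Y ^+ e) -> Y ^+ e = 0.
Proof.
move=> eq_rk; apply/eqP; rewrite -mxrank_eq0; apply/eqP.
set N := Y ^+ e in eq_rk *; pose B := row_base N.
have eqB : (B :=: N)%MS := eq_row_base N.
have freeB : row_free B := row_base_free N.
clearbody B.
have BX : (B *m X <= B)%MS.
  rewrite (eqmxMr X eqB) eqB.
  exact: Ypow_stable.
have BY : (B *m Y :=: B)%MS.
  apply: (eqmx_trans (eqmxMr Y eqB)).
  apply: eqmx_trans (eqmx_sym eqB).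
  have : (N *m Y == N)%MS.
    by rewrite -(geq_leqif (mxrank_leqif_eq _)) -[N *m Y]exprSr ?eq_rk // Ypow_sub.
  by move/eqmxP.
have /submxP[U EU] := BX.
have /submxP[V EV] : (B *m Y <= B)%MS by rewrite BY.
apply: (no_invertible_jordan_pair (U := U) (V := V)).
  apply: (row_free_inj freeB); rewrite mulmxBl.
  rewrite -!mulmxA -EV -EU.
  rewrite !mulmxA -EU -EV -!mulmxA -mulmxBr; congr (_ *m _).
  exact: rel.
rewrite -row_full_unit /row_full.
have := mxrankMfree V freeB; rewrite -EV BY.
by rewrite eqB => <-.
Qed.

Lemma rank_Ypow e : (\rank (Y ^+ e) <= n - e)%N.
Proof.
elim: e => [|e IH]; first by rewrite subn0 rank_leq_row.
have [/rank_Ypow_eq Y0|ne] := eqVneq (\rank (Y ^+ e.+1)) (\rank (Y ^+ e)).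
  by rewrite exprSr Y0 mul0r mxrank0.
have := mxrankS (Ypow_sub (leqnSn e)); lia.
Qed.

Lemma Ypow_eq0 e : (n <= e)%N -> Y ^+ e = 0.
Proof.
move=> le_ne; apply/eqP; rewrite -mxrank_eq0 -leqn0.
by have := rank_Ypow e; rewrite (eqP le_ne).
Qed.

End Ranks.

(** * Monic polynomials in X with coefficients in k[Y] *)

Lemma span_linear (k : fieldType) (U V : vectType k) (f : {linear U -> V})
    (s : seq U) (W : {vspace V}) :
  {in s, forall u, f u \in W} -> {in <<s>>%VS, forall u, f u \in W}.
Proof.
move=> sW u /(coord_span (X := in_tuple s)) ->.
rewrite linear_sum memv_suml // => i _; rewrite linearZ memvZ //.
by rewrite sW // mem_nth.
Qed.

Section Filtration.
Variables (k : fieldType) (n : nat) (X Y : 'M[k]_n).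
Hypothesis rel : X * Y - Y * X = Y ^+ 2.
Hypothesis Yn0 : forall e, (n <= e)%N -> Y ^+ e = 0.

(** Polynomials of degree less than d in X, coefficients in k[Y] on the left;
    the bound n on the powers of Y loses nothing because Y^n = 0. *)
Definition Xfilt d : {vspace 'M[k]_n} :=
  <<[seq Y ^+ i * X ^+ l | l <- iota 0 d, i <- iota 0 n]>>%VS.

Lemma mem_Xfilt d i l : (l < d)%N -> Y ^+ i * X ^+ l \in Xfilt d.
Proof.
move=> ld; have [/Yn0 ->|lt_in] := leqP n i; first by rewrite mul0r mem0v.
by apply/memv_span/allpairsP; exists (l, i); rewrite !mem_iota.
Qed.

Lemma Xfilt_linear d (f : {linear 'M[k]_n -> 'M[k]_n}) (W : {vspace 'M[k]_n}) :
  (forall i l, (l < d)%N -> f (Y ^+ i * X ^+ l) \in W) ->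
  {in Xfilt d, forall T, f T \in W}.
Proof.
move=> fW; apply: span_linear => _ /allpairsP[[l i] /= [+ _ ->]].
by rewrite mem_iota; apply: fW.
Qed.

Lemma Xfilt_sub d d' : (d <= d')%N -> (Xfilt d <= Xfilt d')%VS.
Proof.
move=> le_dd'; apply/subvP; apply: (Xfilt_linear (f := idfun)) => i l ld.
exact/mem_Xfilt/(leq_trans ld).
Qed.

Lemma Xfilt_mulY d i T : T \in Xfilt d -> Y ^+ i * T \in Xfilt d.
Proof.
move: T; apply: (Xfilt_linear (f := mulmx (Y ^+ i))) => j l ld.
by rewrite /= mulmxE mulrA -exprD mem_Xfilt.
Qed.

(** Moving X to the right of Y^i costs only a term of lower degree in X:
    X Y^i = Y^i X + i Y^(i+1). *)
Lemma Xfilt_mulX d j T : T \in Xfilt d -> X ^+ j * T \in Xfilt (j + d).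
Proof.
elim: j T => [|j IH] T TF; first by rewrite expr0 mul1r.
rewrite exprS -mulrA addSn; move: (X ^+ j * T) (IH _ TF) => {IH TF} {}T.
move: T; apply: (Xfilt_linear (f := mulmx X)) => i l ld.
rewrite /= mulmxE mulrA (jordan_swapX rel) -mulrA mulrDl -exprS mulrDr.
rewrite memvD ?mem_Xfilt // mulrA mulrnAr -exprSr mulrnAl rpredMn //.
by rewrite mem_Xfilt // ltnS ltnW.
Qed.

Lemma Xfilt_mulr d j T : T \in Xfilt d -> T * X ^+ j \in Xfilt (d + j).
Proof.
move: T; apply: (Xfilt_linear (f := mulmxr (X ^+ j))) => i l ld.
by rewrite /= mulmxE -mulrA -exprD mem_Xfilt // ltn_add2r.
Qed.

(** The degree is attached to the expression of T and not to T itself: the same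
    matrix can be monic of several degrees. *)
Definition monicX d T := (T - X ^+ d \in Xfilt d).

Lemma monicX_mul_filt c d S T : monicX c S -> T \in Xfilt d -> S * T \in Xfilt (c + d).
Proof.
rewrite /monicX => mS TF; rewrite -(subrK (X ^+ c) S) mulrDl memvD ?Xfilt_mulX //.
move: (S - _) mS; apply: (Xfilt_linear (f := mulmxr T)) => i l ld.
rewrite /= mulmxE -mulrA Xfilt_mulY //.
by apply: (subvP (Xfilt_sub _)) (Xfilt_mulX l TF); lia.
Qed.

Lemma monicX_mul c d S T : monicX c S -> monicX d T -> monicX (c + d) (S * T).
Proof.
move=> mS mT; rewrite /monicX.
have -> : S * T - X ^+ (c + d) = S * (T - X ^+ d) + (S - X ^+ c) * X ^+ d.
  by rewrite exprD mulrBr mulrBl addrA subrK.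
apply: memvD; first exact: monicX_mul_filt.
exact: Xfilt_mulr.
Qed.

(** A relation Y^e T = 0 with T monic of degree J e rewrites Y^e X^l, for
    l >= J e, into monomials with a larger power of Y, or the same power of Y
    and a smaller power of X; both directions are well founded as Y is
    nilpotent. *)
Lemma monicX_spanning (J : nat -> nat) (W : {vspace 'M[k]_n}) :
  (forall e, exists2 T, monicX (J e) T & Y ^+ e * T = 0) ->
  (forall e l, (l < J e)%N -> Y ^+ e * X ^+ l \in W) ->
  forall e l, Y ^+ e * X ^+ l \in W.
Proof.
move=> kills JW e.
have [m le_m] := ubnP (n - e); elim: m e le_m => // m IHm e le_m l.
have [/Yn0 ->|lt_en] := leqP n e; first by rewrite mul0r mem0v.
have {}IHm i l' : (0 < i)%N -> Y ^+ (e + i) * X ^+ l' \in W.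
  move=> i_gt0; apply: IHm; lia.
have [d le_d] := ubnP l; elim: d l le_d => // d IHd l le_d.
have [/JW //|le_Jl] := ltnP l (J e).
have [T mT YT0] := kills e.
have /(Xfilt_mulr (l - J e)) : T - X ^+ J e \in Xfilt (J e) := mT.
rewrite subnKC // mulrBl -exprD subnKC // => TF.
have -> : Y ^+ e * X ^+ l = - (Y ^+ e * (T * X ^+ (l - J e) - X ^+ l)).
  by rewrite mulrBr mulrA YT0 mul0r sub0r opprK.
rewrite memvN; move: (_ - _) TF; apply: (Xfilt_linear (f := mulmx (Y ^+ e))) => i l' lt_l'.
rewrite /= mulmxE mulrA -exprD; case: i => [|i]; last exact: IHm.
by rewrite addn0 IHd //; apply: leq_trans lt_l' _.
Qed.

End Filtration.

(** * The Cayley-Hamilton theorem over the dual numbers *)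

Lemma char_poly_root (R : comNzRingType) g (C : 'M[R]_g) :
  \sum_(l < size (char_poly C)) (char_poly C)`_l *: C ^+ l = 0.
Proof.
case: g C => [|g] C; first by rewrite [LHS]flatmx0 [RHS]flatmx0.
apply: etrans (Cayley_Hamilton C).
rewrite -[X in horner_mx _ X]coefK poly_def rmorph_sum.
by apply: eq_bigr => l _; rewrite /= horner_mxZ rmorphXn /= horner_mx_X.
Qed.

(** Equality modulo the kernel of K plays the role of equality in a quotient of
    M.  The rows of G are elements of M whose images are killed by Y^2, hence
    they generate a module over the dual numbers k[y]/(y^2).  Dual numbers are
    represented by polynomials in y of which only the coefficients of degree 0
    and 1 are looked at; this keeps the coefficient ring commutative, as the
    Cayley-Hamilton theorem requires. *)
Section DualCayleyHamilton.
Variables (k : fieldType) (n g : nat) (G : 'M[k]_(g, n)) (X Y : 'M[k]_n).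
Variables (p : nat) (K : 'M[k]_(n, p)).
Hypothesis rel : X * Y - Y * X = Y ^+ 2.

(** Stated for equations rather than as invariance of the kernel of K, because
    it serves to rewrite in the quotient. *)
Definition stab (T : 'M[k]_n) :=
  forall m (A B : 'M[k]_(m, n)), A *m K = B *m K -> A *m T *m K = B *m T *m K.

Lemma stabX T l : stab T -> stab (T ^+ l).
Proof.
move=> sT m A B AB; elim: l => [|l IH]; first by rewrite expr0 !mulmx1.
by rewrite exprSr -mulmxE !mulmxA; apply: sT.
Qed.

Hypothesis sX : stab X.
Hypothesis sY : stab Y.
Hypothesis GYY : G *m Y *m Y *m K = 0.

(** The rows of B are coordinate vectors over the dual numbers with respect to
    the generators G; this is the matrix of the elements that they denote. *)
Definition dualact m (B : 'M[{poly k}]_(m, g)) : 'M[k]_(m, n) :=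
  map_mx (coefp 0) B *m G + map_mx (coefp 1) B *m G *m Y.

Lemma GYYK m (B : 'M[k]_(m, g)) : B *m G *m Y *m Y *m K = 0.
Proof. by rewrite -(mulmx0 _ B) -GYY !mulmxA. Qed.

Variable C : 'M[{poly k}]_g.
Hypothesis GXK : G *m X *m K = dualact C *m K.

Lemma dualact0 m : dualact (0 : 'M_(m, g)) = 0.
Proof.
have map0 i : map_mx (coefp i) (0 : 'M[{poly k}]_(m, g)) = 0.
  by apply/matrixP=> a b; rewrite !mxE /= coef0.
by rewrite /dualact !map0 !mul0mx addr0.
Qed.

Lemma dualactD m : {morph @dualact m : B B' / B + B'}.
Proof.
move=> B B'; have mapD i : map_mx (coefp i) (B + B') = map_mx (coefp i) B + map_mx (coefp i) B'.
  by apply/matrixP=> a b; rewrite !mxE /= coefD.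
by rewrite /dualact !mapD !mulmxDl addrACA.
Qed.

(** If X acts on the generators through the matrix C, it acts on coordinates by
    right multiplication with C: the correction in YX = XY - Y^2 vanishes in
    the quotient. *)
Lemma dualact_mulX m (B : 'M[{poly k}]_(m, g)) :
  dualact B *m X *m K = dualact (B *m C) *m K.
Proof.
pose C0 := map_mx (coefp 0) C; pose C1 := map_mx (coefp 1) C.
have GX : G *m X *m K = C0 *m G *m K + C1 *m G *m Y *m K by rewrite GXK mulmxDl.
have GYX : G *m Y *m X *m K = C0 *m G *m Y *m K.
  have -> : G *m Y *m X = G *m X *m Y - G *m Y *m Y.
    rewrite -!mulmxA -mulmxBr; congr (_ *m _).
    by apply/esym/eqP; rewrite subr_eq addrC -subr_eq; apply/eqP.
  by rewrite mulmxBl GYY subr0 (sY GXK) !mulmxDl GYYK addr0.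
have BGX : dualact B *m X *m K = map_mx (coefp 0) B *m (G *m X *m K)
    + map_mx (coefp 1) B *m (G *m Y *m X *m K).
  by rewrite !mulmxDl !mulmxA.
rewrite {}BGX {}GX {}GYX /C0 /C1 {1}/dualact.
have -> : map_mx (coefp 0) (B *m C) = map_mx (coefp 0) B *m map_mx (coefp 0) C.
  apply/matrixP=> i j; rewrite !mxE /= coef_sum; apply: eq_bigr => l _.
  by rewrite !mxE /= coef0M.
have -> : map_mx (coefp 1) (B *m C) = map_mx (coefp 0) B *m map_mx (coefp 1) C
    + map_mx (coefp 1) B *m map_mx (coefp 0) C.
  apply/matrixP=> i j; rewrite !mxE /= coef_sum -big_split /=; apply: eq_bigr => l _.
  by rewrite !mxE /= coefM big_ord_recl big_ord1.
by rewrite /dualact !mulmxDl !mulmxDr !mulmxA addrA.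
Qed.

Lemma dualact_mulXn m (B : 'M[{poly k}]_(m, g)) l :
  dualact B *m X ^+ l *m K = dualact (B *m C ^+ l) *m K.
Proof.
elim: l => [|l IH]; first by rewrite !expr0 !mulmx1.
by rewrite !exprSr -!mulmxE !mulmxA (sX IH) dualact_mulX.
Qed.

Definition dualpoly (q : {poly k}) : 'M[k]_n := (q`_0)%:M + q`_1 *: Y.

Lemma dualact_mulY m (B : 'M[{poly k}]_(m, g)) (q : {poly k}) :
  dualact B *m dualpoly q *m K = dualact (q *: B) *m K.
Proof.
rewrite /dualact /dualpoly !mulmxDr !mulmxDl !mul_mx_scalar -!scalemxAr.
have -> : map_mx (coefp 0) (q *: B) = q`_0 *: map_mx (coefp 0) B.
  by apply/matrixP=> i j; rewrite !mxE /= coef0M.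
have -> : map_mx (coefp 1) (q *: B)
    = q`_0 *: map_mx (coefp 1) B + q`_1 *: map_mx (coefp 0) B.
  by apply/matrixP=> i j; rewrite !mxE /= coefM big_ord_recl big_ord1 /=.
by rewrite !mulmxDl -!scalemxAl GYYK scaler0 addr0 addrA.
Qed.

(** The determinant trick: evaluating the characteristic polynomial of C at X
    acts on coordinates as right multiplication by chi(C) = 0. *)
Lemma dualact_char m (B : 'M[{poly k}]_(m, g)) (chi := char_poly C) :
  dualact B *m (\sum_(l < size chi) dualpoly chi`_l *m X ^+ l) *m K = 0.
Proof.
rewrite mulmx_sumr mulmx_suml.
transitivity (\sum_(l < size chi) dualact (B *m (chi`_l *: C ^+ l)) *m K).
  apply: eq_bigr => l _; rewrite mulmxA (stabX l sX (dualact_mulY B chi`_l)).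
  by rewrite dualact_mulXn -scalemxAl scalemxAr.
rewrite -mulmx_suml -(big_morph _ (@dualactD m) (dualact0 m)) -mulmx_sumr.
by rewrite char_poly_root mulmx0 dualact0 mul0mx.
Qed.

Lemma stab_dualpoly m (A : 'M[k]_(m, n)) N (c : nat -> {poly k}) :
  A *m K = 0 -> A *m (\sum_(l < N) dualpoly (c l) *m X ^+ l) *m K = 0.
Proof.
move=> AK; rewrite mulmx_sumr mulmx_suml big1 // => l _.
rewrite mulmxA (stabX l sX (B := 0)) ?mul0mx //.
rewrite mulmxDr mulmxDl mul_mx_scalar -!scalemxAr -!scalemxAl AK (sY (B := 0)) ?AK ?mul0mx //.
by rewrite !scaler0 addr0.
Qed.

End DualCayleyHamilton.

Section Step.
Variables (k : fieldType) (n : nat) (X Y : 'M[k]_n).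
Hypothesis rel : X * Y - Y * X = Y ^+ 2.
Hypothesis Yn0 : forall e, (n <= e)%N -> Y ^+ e = 0.

Lemma stab_coker (Z T : 'M[k]_n) : (Z *m T <= Z)%MS -> stab (cokermx Z) T.
Proof.
move=> ZT m A B /eqP; rewrite -subr_eq0 -mulmxBl -submxE => AB.
apply/eqP; rewrite -subr_eq0 -!mulmxBl -submxE.
exact: submx_trans (submxMr T AB) ZT.
Qed.

Lemma dualpoly_monic g (C : 'M[{poly k}]_g) (chi := char_poly C) :
  monicX X Y g (\sum_(l < size chi) dualpoly Y chi`_l *m X ^+ l).
Proof.
rewrite /monicX {1}/chi size_char_poly big_ord_recr /=.
have -> : dualpoly Y chi`_g = 1.
  have := char_poly_monic C; rewrite monicE /lead_coef size_char_poly /= => /eqP ->.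
  by rewrite /dualpoly !coef1 scale0r addr0.
rewrite mul1mx addrK memv_suml // => l _.
rewrite mulmxDl mul_scalar_mx -scalemxAl memvD ?memvZ //.
  by have := mem_Xfilt X Yn0 0 (ltn_ord l); rewrite expr0 mul1r.
by have := mem_Xfilt X Yn0 1 (ltn_ord l); rewrite expr1.
Qed.

(** Any complement G of M Y^(e+1) in M Y^e generates M Y^e modulo M Y^(e+2) over
    the dual numbers, by iterating M Y^e = G + (M Y^e) Y twice.  The number of
    generators, hence the degree of the characteristic polynomial, is the
    difference of the two ranks. *)
Lemma monicX_step e : exists2 Q, monicX X Y (\rank (Y ^+ e) - \rank (Y ^+ e.+1)) Q
  & (Y ^+ e *m Q <= Y ^+ e.+2)%MS.
Proof.
set N := Y ^+ e; set N1 := Y ^+ e.+1; set N2 := Y ^+ e.+2.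
have NY : N *m Y = N1 by rewrite /N1 exprSr.
have N1Y : N1 *m Y = N2 by rewrite /N2 exprSr.
have N1_N : (N1 <= N)%MS by rewrite Ypow_sub.
have NX : (N *m X <= N)%MS by apply: Ypow_stable.
have N2X : (N2 *m X <= N2)%MS by apply: Ypow_stable.
have N2Y : (N2 *m Y <= N2)%MS by rewrite -[N2 *m Y]exprSr Ypow_sub.
(* Powers unfold to products, which would derail rewriting by associativity. *)
clearbody N N1 N2.
pose g := \rank (N :\: N1)%MS; pose G : 'M_(g, n) := row_base (N :\: N1)%MS.
have -> : (\rank N - \rank N1)%N = g.
  by rewrite -(mxrank_cap_compl N N1) (capmx_idPr N1_N) addKn.
have /submxP[w EG] : (G <= N)%MS by rewrite eq_row_base diffmxSl.
have /sub_addsmxP[[u v] /= EN] : (N <= G + N1)%MS.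
  rewrite (adds_eqmx (eq_row_base _) (eqmx_refl _)).
  by rewrite -{1}(addsmx_diff_cap_eq N N1) addsmxS ?capmxSr.
clearbody G.
have /submxP[D EX] : (G *m X <= N)%MS.
  rewrite EG -mulmxA (submx_trans (submxMl _ _)) //.
pose K := cokermx N2; have N2K : N2 *m K = 0 := mulmx_coker N2.
(* M Y^e = G + (M Y^e) Y, substituted into itself. *)
have EN2 : N = u *m G + v *m u *m G *m Y + v *m v *m N2.
  by rewrite {1}EN -NY {1}EN mulmxDl mulmxDr -N1Y !mulmxA addrA.
have GYY : G *m Y *m Y *m K = 0.
  by rewrite EG -!mulmxA (mulmxA N) NY (mulmxA N1) N1Y N2K mulmx0.
pose C : 'M[{poly k}]_g := map_mx polyC (D *m u) + 'X *: map_mx polyC (D *m v *m u).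
have GXK : G *m X *m K = dualact G Y C *m K.
  have -> : dualact G Y C = D *m u *m G + D *m v *m u *m G *m Y.
    have C0 : map_mx (coefp 0) C = D *m u.
      by apply/matrixP=> i j; rewrite !mxE /= coefD coefXM coefC addr0.
    have C1 : map_mx (coefp 1) C = D *m v *m u.
      by apply/matrixP=> i j; rewrite !mxE /= coefD coefXM !coefC add0r.
    by rewrite /dualact C0 C1.
  by rewrite EX EN2 !mulmxDr mulmxDl -!mulmxA N2K !mulmx0 addr0 !mulmxA.
pose Q := \sum_(l < size (char_poly C)) dualpoly Y (char_poly C)`_l *m X ^+ l.
exists Q; first exact: dualpoly_monic.
have sX : stab K X by apply: stab_coker.
have sY : stab K Y by apply: stab_coker.
(* B = 1 denotes G itself and B = y denotes G Y. *)
have char0 m (B : 'M_(m, g)) := dualact_char rel sX sY GYY GXK B.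
have GQ : G *m Q *m K = 0.
  have <- : dualact G Y 1%:M = G; last exact: char0.
  have C0 : map_mx (coefp 0) (1%:M : 'M[{poly k}]_g) = 1%:M.
    by apply/matrixP=> i j; rewrite !mxE /= coefMn coef1.
  have C1 : map_mx (coefp 1) (1%:M : 'M[{poly k}]_g) = 0.
    by apply/matrixP=> i j; rewrite !mxE /= coefMn coef1 mul0rn.
  by rewrite /dualact C0 C1 !mul0mx mul1mx addr0.
have GYQ : G *m Y *m Q *m K = 0.
  have <- : dualact G Y 'X%:M = G *m Y; last exact: char0.
  have C0 : map_mx (coefp 0) ('X%:M : 'M[{poly k}]_g) = 0.
    by apply/matrixP=> i j; rewrite !mxE /= coefMn coefX mul0rn.
  have C1 : map_mx (coefp 1) ('X%:M : 'M[{poly k}]_g) = 1%:M.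
    by apply/matrixP=> i j; rewrite !mxE /= coefMn coefX.
  by rewrite /dualact C0 C1 !mul0mx mul1mx add0r.
have N2Q : N2 *m Q *m K = 0 by apply: stab_dualpoly.
rewrite submxE -/K; apply/eqP; rewrite EN2 !mulmxDl -!mulmxA (mulmxA G) GQ.
rewrite (mulmxA Y) (mulmxA G) (mulmxA G) GYQ (mulmxA N2).
by rewrite N2Q !mulmx0 !addr0.
Qed.

End Step.

(** * The upper bound *)

Section UpperBound.
Variables (k : fieldType) (n : nat) (X Y : 'M[k]_n).
Hypothesis k_char0 : [pchar k] =i pred0.
Hypothesis rel : X * Y - Y * X = Y ^+ 2.

Let r e := \rank (Y ^+ e).
Let Yn0 := Ypow_eq0 k_char0 rel.

(** The product of the polynomials sending M Y^e into M Y^(e+2), the latter into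
    M Y^(e+4), and so on down to 0. *)
Lemma monicX_kill N e : (n <= e + N.*2)%N ->
  exists2 T, monicX X Y (\sum_(i < N) (r (e + i.*2) - r (e + i.*2).+1)) T
           & Y ^+ e * T = 0.
Proof.
elim: N e => [|N IH] e le_ne.
  exists 1; last by rewrite mulr1 Yn0 // -[e]addn0.
  by rewrite big_ord0 /monicX expr0 subrr mem0v.
have [Q mQ /submxP[D EQ]] := monicX_step rel Yn0 e.
have [|T mT YT] := IH e.+2; first by lia.
exists (Q * T); last by rewrite mulrA [_ * Q]EQ -[LHS]mulmxA [_ *m T]YT mulmx0.
rewrite big_ord_recl addn0; apply: (monicX_mul rel Yn0) => //.
by under eq_bigr => i _ do rewrite /= [bump _ _]add1n doubleS !addnS -!addSn.
Qed.

Lemma telescope_decr (f : nat -> nat) N : (forall e, f e.+1 <= f e)%N ->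
  (\sum_(e < N) (f e - f e.+1) + f N = f 0)%N.
Proof.
move=> decr; elim: N => [|N IH]; first by rewrite big_ord0.
by rewrite big_ord_recr /= -addnA subnK.
Qed.

(** The degrees J e sum to at most r_0 + r_2 + ...: for each fixed i the
    differences r_(e+2i) - r_(e+1+2i) telescope in e to at most r_(2i). *)
Lemma jordan_algebra_span : exists s : seq 'M[k]_n,
  [/\ (size s <= \sum_(i < n) (n - i.*2))%N,
      forall T, T \in s -> exists e l, T = Y ^+ e * X ^+ l
    & forall e l, Y ^+ e * X ^+ l \in <<s>>%VS].
Proof.
pose J e := (\sum_(i < n) (r (e + i.*2) - r (e + i.*2).+1))%N.
exists [seq Y ^+ e * X ^+ l | e <- iota 0 n, l <- iota 0 (J e)]; split.
- rewrite size_allpairs_dep sumnE big_map.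
  under eq_bigr => e _ do rewrite size_iota.
  rewrite -[X in iota 0 X]subn0 -/(index_iota 0 n) big_mkord exchange_big /=.
  apply: leq_sum => i _.
  apply: leq_trans (rank_Ypow k_char0 rel i.*2); rewrite -/(r _).
  have := @telescope_decr (fun e => r (e + i.*2)) n; rewrite add0n => <-.
    by rewrite leq_addr.
  by move=> e; rewrite mxrankS // Ypow_sub.
- by move=> T /allpairsPdep[e [l [_ _ ->]]]; exists e, l.
apply: (monicX_spanning Yn0 (J := J)) => [e|e l lt_lJ].
  by apply: monicX_kill; lia.
have [/Yn0 ->|lt_en] := leqP n e; first by rewrite mul0r mem0v.
apply/memv_span/allpairsPdep; exists e, l.
by rewrite !mem_iota.
Qed.

End UpperBound.

Lemma sum_minus_double n :
  (\sum_(i < n) (n - i.*2) = (n + 1) ^ 2 %/ 4)%N.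
Proof.
have [m le_m] := ubnP n; elim: m n le_m => // m IH [|[|n]] le_m.
- by rewrite big_ord0.
- by rewrite big_ord1.
rewrite big_ord_recl big_ord_recr /=.
under eq_bigr => i _ do rewrite [bump _ _]add1n doubleS !subSS.
rewrite IH; last by lia.
have -> : ((n.+2 + 1) ^ 2 = (n + 2) * 4 + (n + 1) ^ 2)%N by lia.
rewrite divnMDl // /bump /=; lia.
Qed.

(** * Linear independence when Y has maximal nilpotency index *)

Section LowerBound.
Variables (k : fieldType) (n : nat) (X Y : 'M[k]_n).
Hypothesis k_char0 : [pchar k] =i pred0.
Hypothesis rel : X * Y - Y * X = Y ^+ 2.

Definition commY (T : 'M[k]_n) : 'M[k]_n := T * Y - Y * T.

Lemma commY_linear : linear commY.
Proof.
move=> c S T; rewrite /commY -!mulmxE mulmxDl mulmxDr -scalemxAl -scalemxAr opprD addrACA.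
by rewrite scalerBr.
Qed.

HB.instance Definition _ :=
  GRing.isLinear.Build k 'M[k]_n 'M[k]_n *:%R commY commY_linear.

Lemma commY_Ymul i T : commY (Y ^+ i * T) = Y ^+ i * commY T.
Proof. by rewrite /commY mulrBr !mulrA -exprS -exprSr. Qed.

Lemma commY_mulX T : commY (T * X) = commY T * X + T * Y ^+ 2.
Proof.
by rewrite /commY -rel mulrBl mulrBr !mulrA [RHS]addrC addrA subrK.
Qed.

Lemma commY_mulY T i : commY (T * Y ^+ i) = commY T * Y ^+ i.
Proof. by rewrite /commY mulrBl -!mulrA -exprS -exprSr. Qed.

Fixpoint adY m : 'End('M[k]_n) :=
  if m is m'.+1 then (linfun commY \o adY m')%VF else \1%VF.

Arguments adY : simpl never.

Lemma adYS m T : adY m.+1 T = commY (adY m T).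
Proof. by rewrite -[adY m.+1]/(linfun commY \o adY m)%VF comp_lfunE lfunE. Qed.

Lemma adY_Ymul m i T : adY m (Y ^+ i * T) = Y ^+ i * adY m T.
Proof. by elim: m => [|m IH]; rewrite ?id_lfunE // !adYS IH commY_Ymul. Qed.

(** Leibniz rule; only two terms survive since commY X = Y^2 is itself killed. *)
Lemma adY_mulX m T :
  adY m.+1 (T * X) = adY m.+1 T * X + (adY m T * Y ^+ 2) *+ m.+1.
Proof.
elim: m => [|m IH]; first by rewrite !adYS !id_lfunE commY_mulX.
rewrite adYS IH linearD linearMn /= commY_mulX commY_mulY -!adYS -addrA.
by rewrite -mulrS.
Qed.

(** Each of the d factors X must be hit exactly once, in any of the d! orders. *)
Lemma adY_X d : adY d (X ^+ d) = Y ^+ d.*2 *+ d`!.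
Proof.
(* The induction also needs that one more step gives 0. *)
have [] : adY d (X ^+ d) = Y ^+ d.*2 *+ d`! /\ adY d.+1 (X ^+ d) = 0; last by [].
elim: d => [|d [IH1 IH2]].
  by rewrite adYS id_lfunE /commY expr0 mul1r mulr1 subrr.
rewrite exprSr !adY_mulX (adYS d.+1) IH2 linear0 !mul0r mul0rn !add0r IH1; split=> //.
rewrite mulrnAl -exprD -mulrnA factS mulnC doubleS.
by rewrite addn2.
Qed.

Lemma adY_X_eq0 d : adY d.+1 (X ^+ d) = 0.
Proof. by rewrite adYS adY_X linearMn /= /commY -exprSr -exprS subrr mul0rn. Qed.

Hypothesis Yn0 : Y ^+ n = 0.
Hypothesis Yn1 : Y ^+ n.-1 != 0.

(** Multiplying a relation between powers of Y by the right power of Y isolates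
    its lowest term as a multiple of Y^(n-1). *)
Lemma free_Ypow a m : (a + m = n)%N -> free [seq Y ^+ j | j <- iota a m].
Proof.
elim: m a => [|m IH] a am; first by rewrite /= nil_free.
rewrite /= free_cons IH ?addSnnS // andbT; apply/negP => Ya.
case/negP: Yn1; rewrite -memv0.
have -> : Y ^+ n.-1 = Y ^+ m * Y ^+ a by rewrite -exprD; congr (_ ^+ _); lia.
apply: (@span_linear _ _ _ (mulmx (Y ^+ m)) _ 0%VS _ _ Ya).
move=> _ /mapP[j + ->]; rewrite mem_iota => /andP[lt_aj _] /=.
rewrite mulmxE -exprD memv0.
have -> : (m + j = n + (m + j - n))%N by lia.
by rewrite exprD Yn0 mul0r.
Qed.

(** W is filtered by the kernels of the iterates of ad Y.  The d-th iterate
    embeds the d-th graded piece, and its image contains Y^j for 2d <= j < n,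
    being 1/d! times the image of Y^(j-2d) X^d. *)
Lemma dim_ker_adY (W : {vspace 'M[k]_n}) d :
  (forall i j, Y ^+ i * X ^+ j \in W) ->
  (\sum_(j < d) (n - j.*2) <= \dim (W :&: lker (adY d)))%N.
Proof.
move=> YX_W; elim: d => [|d IH]; first by rewrite big_ord0.
set K := (W :&: lker (adY d.+1))%VS.
have KE : (K :&: lker (adY d) = W :&: lker (adY d))%VS.
  rewrite -capvA; congr (_ :&: _)%VS; apply/capv_idPr/subvP => T.
  by rewrite !memv_ker => /eqP T0; rewrite adYS T0 linear0.
rewrite big_ord_recr /= -(limg_ker_dim (adY d) K) KE leq_add //.
have [lt_dn|] := ltnP d.*2 n; last by rewrite -subn_eq0 => /eqP ->.
have := free_Ypow (subnKC (ltnW lt_dn)); rewrite /free => /eqP.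
rewrite size_map size_iota => <-; apply/dimvS/span_subvP => _ /mapP[j + ->].
rewrite mem_iota => /andP[le_dj _].
have fact0 : (d`!)%:R != 0 :> k by rewrite (pcharf0P k).1 // -lt0n fact_gt0.
have -> : Y ^+ j = adY d ((d`!)%:R^-1 *: (Y ^+ (j - d.*2) * X ^+ d)).
  rewrite linearZ /= adY_Ymul adY_X mulrnAr -exprD subnK // -scaler_nat.
  by rewrite scalerA mulVf // scale1r.
apply: memv_img; rewrite memv_cap memvZ //= memv_ker linearZ /=.
by rewrite adY_Ymul adY_X_eq0 mulr0 scaler0.
Qed.

End LowerBound.

(** * Jordan blocks *)

Section JordanBlock.
Variables (k : fieldType) (n : nat).

Lemma jordan_block0X e i j :
  (jordan_block n (0 : k) ^+ e) i j = (i + e == j)%N%:R.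
Proof.
elim: e i j => [|e IH] i j; first by rewrite expr0 addn0 !mxE.
rewrite exprSr !mxE; have [lt_in|le_ni] := ltnP (i + e) n.
  rewrite (bigD1 (Ordinal lt_in)) //= big1 ?addr0 => [|l ne_l].
    by rewrite IH /= eqxx mul1r mxE mul0rn add0r /= addnS.
  rewrite IH; case: eqP => [E|_]; last by rewrite mul0r.
  by case/eqP: ne_l; apply: ord_inj.
rewrite big1 => [|l _]; last first.
  by rewrite IH (_ : (_ == _) = false) ?mul0r //; have := ltn_ord l; lia.
by rewrite (_ : (_ == _) = false) //; have := ltn_ord j; lia.
Qed.

End JordanBlock.

(** The last basis vector is an eigenvector of the block for lambda, so a
    nilpotent Y forces lambda = 0; the (n-1)-st power of the nilpotent block has
    a 1 in its corner. *)
Lemma full_jordan_block_nilp (k : fieldType) n (Y : 'M[k]_n) :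
  (0 < n)%N -> full_jordan_block Y -> Y ^+ n = 0 -> Y ^+ n.-1 != 0.
Proof.
case: n Y => // n Y _ [lambda [P Pu /(simmxP Pu) PY]] Yn0.
have PYX e : P * Y ^+ e = jordan_block n.+1 lambda ^+ e * P.
  elim: e => [|e IH]; first by rewrite !expr0 mulr1 mul1r.
  by rewrite !exprSr mulrA IH -!mulrA; congr (_ * _).
have Jn0 : jordan_block n.+1 lambda ^+ n.+1 = 0.
  apply: (mulIr (x := P)); first by rewrite unitmxE in Pu *.
  by rewrite -PYX Yn0 mulr0 mul0r.
have lambda0 : lambda = 0.
  pose v := row ord_max (1%:M : 'M[k]_n.+1).
  have vJ : v *m jordan_block n.+1 lambda = lambda *: v.
    rewrite /v -row_mul mul1mx; apply/rowP=> j; rewrite !mxE.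
    have -> : ((ord_max : 'I_n.+1).+1 == j) = false by have := ltn_ord j; rewrite /=; lia.
    by rewrite addr0 mulr_natr.
  have vJX e : v *m jordan_block n.+1 lambda ^+ e = lambda ^+ e *: v.
    elim: e => [|e IH]; first by rewrite !expr0 mulmx1 scale1r.
    by rewrite exprSr -mulmxE mulmxA IH -scalemxAl vJ scalerA -exprSr.
  have /rowP/(_ ord_max) := vJX n.+1; rewrite Jn0 mulmx0 !mxE eqxx mulr1.
  by move/esym/eqP; rewrite expf_eq0 => /andP[_ /eqP].
apply/eqP => Yn; have /matrixP/(_ ord0 ord_max) : jordan_block n.+1 lambda ^+ n = 0.
  apply: (mulIr (x := P)); first by rewrite unitmxE in Pu *.
  by rewrite -PYX Yn mulr0 mul0r.
by rewrite lambda0 jordan_block0X mxE add0n eqxx => /eqP; rewrite oner_eq0.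
Qed.

(** With X e_i = - i e_(i+1) both XY and YX shift by 2, with coefficients - i
    and - (i+1), which differ by 1. *)
Lemma jordan_block_partner (k : fieldType) n (Y := jordan_block n (0 : k)) :
  exists X, X * Y - Y * X = Y ^+ 2.
Proof.
exists (\matrix_(i, j) (- (i%:R) *+ (i.+1 == j))).
apply/matrixP => i j; rewrite jordan_block0X addn2 !mxE.
have [lt_in|le_ni] := ltnP i.+1 n.
  rewrite (bigD1 (Ordinal lt_in)) //= big1 ?addr0 => [|l ne_l]; last first.
    rewrite !mxE; case: eqP => [E|_]; last by rewrite mulr0n mul0r.
    by case/eqP: ne_l; apply: ord_inj.
  rewrite (bigD1 (Ordinal lt_in)) //= big1 ?addr0 => [|l ne_l]; last first.
    rewrite !mxE mul0rn add0r; case: eqP => [E|_]; last by rewrite mul0r.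
    by case/eqP: ne_l; apply: ord_inj.
  rewrite !mxE /= eqxx !mul0rn !add0r !mulr1n mul1r.
  case: eqP => _; rewrite ?mulr1n ?mulr0n ?mulr1 ?mulr0 ?subrr //.
  by rewrite -natr1 opprK addKr.
have out (l : 'I_n) : (i.+1 == l) = false by have := ltn_ord l; lia.
rewrite !big1 ?subr0 => [|l _|l _].
- by rewrite (_ : (_ == _) = false) //; have := ltn_ord j; lia.
- by rewrite !mxE out mul0rn add0r mul0r.
by rewrite !mxE out mulr0n mul0r.
Qed.

(** * Representations of the Jordan plane *)

Section Generators.
Variable k : fieldType.
Local Notation kxy := {malg k[{fmonom bool}]}.
Local Notation JP := (jordan_plane k).

Lemma free_word_cons (b : bool) (s : seq bool) :
  << FMonom (b :: s) >> = << fmu b >> * << FMonom s >> :> kxy.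
Proof. by rewrite malgM_def fgmulUU mulr1 [mmul _ _]fmmulE fmuE. Qed.

Lemma jp_word_span (u : JP) : exists s : seq (k * seq bool),
  u = \sum_(p <- s) p.1 *: \prod_(b <- p.2) (if b then jp_y k else jp_x k).
Proof.
rewrite -[u]reprK; move: (repr u) => v {u}.
exists [seq (v@_m, m : seq bool) | m <- finmap.enum_fset (msupp v)].
rewrite big_map {1}[v]monalgE raddf_sum; apply: eq_bigr => -[s] _ /=.
have -> : << v@_(FMonom s) *g FMonom s >> = v@_(FMonom s) *: (<< FMonom s >> : kxy).
  by apply/malgP => m; rewrite mcoeffZ !mcoeffU mulr_natr.
rewrite (pi_jp_scale _ _); congr (_ *: _).
elim: s => [|b s IH]; first by rewrite big_nil -fmoneE -[RHS]pi_jp_one.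
rewrite big_cons free_word_cons pi_jpM IH; congr (_ * _).
by case: b.
Qed.

Lemma jp_range_sub n (rho : {lrmorphism JP -> 'M[k]_n}) (W : {vspace 'M[k]_n}) :
  1 \in W -> {in W, forall T, rho (jp_x k) * T \in W} ->
  {in W, forall T, rho (jp_y k) * T \in W} -> forall u, rho u \in W.
Proof.
move=> W1 WX WY u; have [s ->] := jp_word_span u.
rewrite linear_sum memv_suml // => -[c w] _; rewrite linearZ memvZ //=.
elim: w => [|b w IH]; first by rewrite big_nil rmorph1.
by rewrite big_cons rmorphM; case: b; [apply: WY | apply: WX].
Qed.

End Generators.

Section Existence.
Variables (k : fieldType) (n : nat) (X Y : 'M[k]_n.+1).
Hypothesis rel : X * Y - Y * X = Y ^+ 2.
Local Notation kxy := {malg k[{fmonom bool}]}.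
Local Notation JP := (jordan_plane k).

(** The representation is first defined on the free algebra, where it is the
    universal extension of the map on words, and then shown to kill the defining
    ideal. *)
Definition word_eval (m : {fmonom bool}) : 'M[k]_n.+1 :=
  \prod_(b <- (m : seq bool)) (if b then Y else X).

Lemma word_eval_morph : mmorphism word_eval.
Proof.
split=> [m m'|]; rewrite /word_eval.
  by rewrite [mmul _ _]fmmulE /= big_cat.
by rewrite [mone]fmoneE big_nil.
Qed.

HB.instance Definition _ := isMultiplicative.Build {fmonom bool} 'M[k]_n.+1
  word_eval word_eval_morph.

Definition free_eval : kxy -> 'M[k]_n.+1 := mmap scalar_mx word_eval.

HB.instance Definition _ := Algebra.Additive.on free_eval.

Lemma free_eval_monoid : monoid_morphism free_eval.
Proof.
suff [evM ev1] : multiplicative free_eval by split.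
apply: commr_mmap_is_multiplicative => v m m'.
exact: comm_mx_sym (comm_mx_scalar _ _).
Qed.

HB.instance Definition _ := GRing.isMonoidMorphism.Build kxy 'M[k]_n.+1 free_eval
  free_eval_monoid.

Lemma free_evalZ c u : free_eval (c *: u) = c *: free_eval u.
Proof. by rewrite /free_eval mmapZ /= -mul_scalar_mx. Qed.

Lemma free_eval_letter b : free_eval << fmu b >> = if b then Y else X.
Proof.
by rewrite /free_eval mmapU mul1r /word_eval fmuE /= big_seq1.
Qed.

Lemma free_eval_ideal u : u \in ideal2 (jordan_rel k) -> free_eval u = 0.
Proof.
move=> /ideal2P[s ->]; rewrite rmorph_sum big1 // => p _; rewrite 2!rmorphM /=.
have -> : free_eval (jordan_rel k) = 0.
  apply: etrans (rmorph_jordan_rel free_eval (free_x k) (free_y k)) _.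
  have fx : free_eval (free_x k) = X := free_eval_letter false.
  have fy : free_eval (free_y k) = Y := free_eval_letter true.
  by rewrite /= fx fy rel subrr.
by rewrite mulr0 mul0r.
Qed.

Definition jp_eval (u : JP) : 'M[k]_n.+1 := free_eval (repr u).

Lemma jp_eval_pi (v : kxy) : jp_eval (\pi_JP v)%qT = free_eval v.
Proof.
apply/eqP; rewrite -subr_eq0 /jp_eval -rmorphB; apply/eqP/free_eval_ideal.
exact: repr_jp.
Qed.

Lemma jp_eval_linear : linear jp_eval.
Proof.
move=> c u v; rewrite -[u]reprK -[v]reprK -[c *: _](pi_jp_scale c) -pi_jp_add.
by rewrite !jp_eval_pi rmorphD; congr (_ + _); apply: free_evalZ.
Qed.

Lemma jp_eval_monoid : monoid_morphism jp_eval.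
Proof.
split; first by rewrite -[1]pi_jp_one jp_eval_pi rmorph1.
by move=> u v; rewrite -[u]reprK -[v]reprK -pi_jpM !jp_eval_pi rmorphM.
Qed.

HB.instance Definition _ := GRing.isLinear.Build k JP 'M[k]_n.+1 *:%R jp_eval
  jp_eval_linear.
HB.instance Definition _ := GRing.isMonoidMorphism.Build JP 'M[k]_n.+1 jp_eval
  jp_eval_monoid.

Lemma jordan_rep_exists : exists rho : {lrmorphism JP -> 'M[k]_n.+1},
  rho (jp_y k) = Y.
Proof. by exists jp_eval; rewrite /= jp_eval_pi free_eval_letter. Qed.

End Existence.

Section ZeroRep.
Variable k : fieldType.
Local Notation JP := (jordan_plane k).

(** Evaluation of words lands in a nonzero ring, whereas the matrices of size 0
    form the trivial ring, so this case has its own representation. *)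
Definition zero_rep (u : JP) : 'M[k]_0 := 0.

Lemma zero_rep_linear : linear zero_rep.
Proof. by move=> c u v; rewrite [LHS]flatmx0 [RHS]flatmx0. Qed.

Lemma zero_rep_monoid : monoid_morphism zero_rep.
Proof. by split=> [|u v]; rewrite [LHS]flatmx0 [RHS]flatmx0. Qed.

HB.instance Definition _ := GRing.isLinear.Build k JP 'M[k]_0 *:%R zero_rep
  zero_rep_linear.
HB.instance Definition _ := GRing.isMonoidMorphism.Build JP 'M[k]_0 zero_rep
  zero_rep_monoid.

End ZeroRep.

(** * The dimension of the image algebra *)

Theorem theorem8p1 (k : closedFieldType) (k_char0 : [pchar k] =i pred0)
    (n : nat) :
  [/\ forall rho : {lrmorphism jordan_plane k -> 'M[k]_n},
        (~~ odd n -> \dim (linear_range rho) <= (n * (n + 2)) %/ 4)%N /\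
        (odd n -> \dim (linear_range rho) <= (n + 1) ^ 2 %/ 4)%N,
      forall rho : {lrmorphism jordan_plane k -> 'M[k]_n},
        full_jordan_block (rho (jp_y k)) ->
        (~~ odd n -> \dim (linear_range rho) = (n * (n + 2)) %/ 4)%N /\
        (odd n -> \dim (linear_range rho) = (n + 1) ^ 2 %/ 4)%N
    & exists rho : {lrmorphism jordan_plane k -> 'M[k]_n},
        full_jordan_block (rho (jp_y k))].
Proof.
have parity d (R : nat -> nat -> Prop) : R d ((n + 1) ^ 2 %/ 4)%N ->
    (~~ odd n -> R d ((n * (n + 2)) %/ 4)%N) /\
    (odd n -> R d ((n + 1) ^ 2 %/ 4)%N).
  move=> H; split=> // even_n; suff <- : ((n + 1) ^ 2 %/ 4 = n * (n + 2) %/ 4)%N by [].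
  rewrite -(even_halfK even_n); move: n./2 => m; lia.
have rel (rho : {lrmorphism jordan_plane k -> 'M[k]_n}) :
  rho (jp_x k) * rho (jp_y k) - rho (jp_y k) * rho (jp_x k) = rho (jp_y k) ^+ 2.
  rewrite -rmorphXn -!rmorphM -rmorphB; apply/eqP; rewrite -subr_eq0 -rmorphB.
  by rewrite jp_relation rmorph0.
have le_dim (rho : {lrmorphism jordan_plane k -> 'M[k]_n}) :
    (\dim (linear_range rho) <= (n + 1) ^ 2 %/ 4)%N.
  have [s [le_s s_mono s_span]] := jordan_algebra_span k_char0 (rel rho).
  rewrite -sum_minus_double; apply: leq_trans le_s; apply: leq_trans (dim_span s).
  apply/dimvS/subvP => _ /mem_linear_range[u <-]; move: u; apply: jp_range_sub.
  - by have := s_span 0 0; rewrite !expr0 mulr1.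
  - apply: (@span_linear _ _ _ (mulmx (rho (jp_x k)))) => _ /s_mono[e [l ->]].
    rewrite /= mulmxE mulrA (jordan_swapX (rel rho)) -mulrA mulrDl -exprS mulrDr.
    by rewrite memvD // mulrnAl mulrnAr rpredMn // mulrA -exprSr.
  apply: (@span_linear _ _ _ (mulmx (rho (jp_y k)))) => _ /s_mono[e [l ->]].
  by rewrite /= mulmxE mulrA -exprS.
split.
- by move=> rho; apply: (parity _ (fun a b => a <= b)%N).
- move=> rho full; apply: (parity _ eq); apply/eqP; rewrite eqn_leq le_dim /=.
  have Yn0 : rho (jp_y k) ^+ n = 0 by apply: (Ypow_eq0 k_char0 (rel rho)).
  rewrite -sum_minus_double.
  have [n0 |n_gt0] := posnP n; first by rewrite big1 // => i _; lia.
  have Yn1 := full_jordan_block_nilp n_gt0 full Yn0.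
  apply: leq_trans (dimvS (capvSl _ (lker (adY (rho (jp_y k)) n)))).
  apply: (dim_ker_adY k_char0 (rel rho) Yn0 Yn1) => i j.
  apply/mem_linear_range; exists (jp_y k ^+ i * jp_x k ^+ j).
  by rewrite rmorphM !rmorphXn.
case: n {parity rel le_dim} => [|m].
  exists (@zero_rep k); exists 0; exists 1%:M; first exact: unitmx1.
  by apply/eqP; rewrite [LHS]flatmx0 [RHS]flatmx0.
have [X XY] := jordan_block_partner k m.+1.
have [rho rhoY] := jordan_rep_exists XY; exists rho; rewrite rhoY.
exists 0; exists 1%:M; first exact: unitmx1.
by apply/simmxP; rewrite ?unitmx1 // mul1mx mulmx1.
Qed.
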